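(* For every integer $n \ge 1$, $$M_n = \prod_{p} p^{\varepsilon(p) + \operatorname{ord}_p(n)},$$ where the product is extended over all odd primes $p$ for which the Mersenne order $v(p)$ divides $n$.
   Context: For $n \ge 1$ let $M_n = 2^n - 1$. For a prime $p$, $\operatorname{ord}_p$ denotes the $p$-adic valuation. For an odd prime $p$, the Mersenne order $v(p)$ is the smallest integer $r \ge 1$ such that $p$ divides $M_r$, and the Wieferich exponent is $\varepsilon(p) = \operatorname{ord}_p(M_{v(p)})$. An empty product equals $1$. *)

(* Defs.v *)
From mathcomp Require Import all_boot cyclic.
Set Implicit Arguments.
Unset Strict Implicit.
Unset Printing Implicit Defensive.

Definition mersenne (n : nat) : nat := 2 ^ n - 1.

Definition is_mersenne_exponent (p : nat) : pred nat :=
  [pred r | (1 <= r) && (odd p ==> (p %| mersenne r))].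

Lemma mersenne_exponent_exists (p : nat) : exists r, is_mersenne_exponent p r.
Proof.
have [p_odd|p_even] := boolP (odd p); last first.
  by exists 1; rewrite /is_mersenne_exponent /= (negbTE p_even).
exists (totient p); rewrite /is_mersenne_exponent /= totient_gt0 odd_gt0 //= p_odd /= /mersenne.
rewrite -eqn_mod_dvd ?expn_gt0 //.
by apply/eqP/Euler_exp_totient; rewrite coprime2n.
Qed.

(* Only the values at odd p are meaningful; an even p gets the value 1. *)
Definition mersenne_order (p : nat) : nat :=
  ex_minn (mersenne_exponent_exists p).

Definition wieferich_exponent (p : nat) : nat :=
  logn p (mersenne (mersenne_order p)).

(* Main.v *)
Require Import Defs.
From mathcomp Require Import all_boot cyclic.
From mathcomp Require Import boolp classical_sets cardinality fsbigop.

(** The primes dividing [2 ^ n - 1] are exactly the odd primes [p] whose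
    Mersenne order divides [n]: the order is the multiplicative order of [2]
    modulo [p]. The formula is therefore the prime factorization of
    [2 ^ n - 1], once its valuation at such a [p] is known. Write [n = k * v]
    with [v] the Mersenne order of [p]. Since [p] divides [2 ^ v - 1], lifting
    the exponent ([logn_subX1]) gives
    [logn p (2 ^ n - 1) = logn p (2 ^ v - 1) + logn p k]. By Fermat's little
    theorem [0 < v < p], so [p] does not divide [v] and
    [logn p k = logn p n].

    Lifting the exponent rests on [x ^ k - 1 = (x - 1) * S] with
    [S = 1 + x + ... + x ^ (k - 1)]. When [x = 1 %[mod p]], [S = k %[mod p]],
    so [S] is prime to [p] as soon as [k] is; and when [k = p] is odd, [S] is
    divisible by [p] exactly once. These two cases generate all [k]. *)

Local Open Scope classical_set_scope.
Local Open Scope nat_scope.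

Lemma eqn_modX (d a b k : nat) : a = b %[mod d] -> a ^ k = b ^ k %[mod d].
Proof. by move=> eq_ab; rewrite -modnXm eq_ab modnXm. Qed.

Lemma dvdn_sub1 (d x : nat) : 0 < x -> (d %| x - 1) = (x == 1 %[mod d]).
Proof. by move=> x_gt0; rewrite eqn_mod_dvd. Qed.

Lemma subX1 (x k : nat) : x ^ k - 1 = (x - 1) * \sum_(i < k) x ^ i.
Proof. by rewrite !subn1 predn_exp. Qed.

Lemma geometric_sum_gt0 (x k : nat) : 0 < k -> 0 < \sum_(i < k) x ^ i.
Proof. by case: k => // k _; rewrite big_ord_recl. Qed.

Lemma geometric_sum_mod (p x k : nat) :
  x = 1 %[mod p] -> \sum_(i < k) x ^ i = k %[mod p].
Proof.
move=> x1; rewrite -modn_summ.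
under eq_bigr => i _ do rewrite (eqn_modX _ _ _ i x1) exp1n.
by rewrite modn_summ sum1_card card_ord.
Qed.

(** The binomial expansion of [(y + 1) ^ i] to first order in [y]. *)
Lemma expnS1_mod_sqr (y i : nat) : y.+1 ^ i = 1 + i * y %[mod y ^ 2].
Proof.
elim: i => [//|i IHi]; rewrite expnS -modnMmr IHi modnMmr.
have -> : y.+1 * (1 + i * y) = i * y ^ 2 + (1 + i.+1 * y).
  rewrite -mulnn mulSn mulnDr muln1 [y * (i * y)]mulnCA mulSn.
  by rewrite addnACA addnA addnC -addnA.
by rewrite modnMDl.
Qed.

(** With [x = y + 1], the sum is [p + 'C(p, 2) * y] modulo [p ^ 2];
    [p] divides [y], and it divides ['C(p, 2)] because it is odd, so the sum is [p %[mod p ^ 2]]. *)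
Lemma logn_geometric_sum_prime (p x : nat) :
  prime p -> odd p -> 0 < x -> p %| x - 1 -> logn p (\sum_(i < p) x ^ i) = 1.
Proof.
move=> p_pr p_odd; case: x => // y _; rewrite subn1 /= => p_y.
set S := \sum_(i < p) _.
have S_mod : S = p %[mod p ^ 2].
  rewrite /S -modn_summ.
  under eq_bigr => i _.
    rewrite -(modn_dvdm (y.+1 ^ i) (dvdn_exp2r 2 p_y)) expnS1_mod_sqr.
    rewrite modn_dvdm ?dvdn_exp2r //.
    over.
  rewrite modn_summ big_split /= sum1_card card_ord -big_distrl /=.
  rewrite -(big_mkord xpredT id) bin2_sum.
  have p_bin : p %| 'C(p, 2) by rewrite prime_dvd_bin //= odd_prime_gt2.
  by apply/eqP; rewrite eqn_mod_dvd ?leq_addr // addKn -mulnn dvdn_mul.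
have p2_S : (p ^ 2 %| S) = false.
  rewrite /dvdn S_mod -/(dvdn _ _) -{2}[p]expn1 dvdn_Pexp2l //.
  exact: prime_gt1.
have S_gt0 : 0 < S by case: (posnP S) p2_S => // ->; rewrite dvdn0.
have p_S : p %| S.
  have p_p2 : p %| p ^ 2 by rewrite dvdn_exp.
  by rewrite /dvdn -(modn_dvdm S p_p2) S_mod modn_dvdm // modnn.
apply/eqP; rewrite eqn_leq -pfactor_dvdn // expn1 p_S andbT.
by rewrite leqNgt -pfactor_dvdn // p2_S.
Qed.

(** Write [k = m * p ^ e] with [m] prime to [p]. Raising to the power [m] leaves
    the valuation of the base minus one unchanged, and each further power [p]
    raises it by one: the base [X = x ^ (m * p ^ e)] reached so far is still [1 %[mod p]]. *)
Lemma logn_subX1 (p x k : nat) :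
    prime p -> odd p -> 1 < x -> p %| x - 1 -> 0 < k ->
  logn p (x ^ k - 1) = logn p (x - 1) + logn p k.
Proof.
move=> p_pr p_odd x_gt1 p_x k_gt0.
have x_gt0 := ltnW x_gt1.
have x1 : x = 1 %[mod p] by apply/eqP; rewrite -dvdn_sub1.
have [m co_pm ->] := pfactor_coprime p_pr k_gt0.
have m_gt0 : 0 < m.
  by rewrite lt0n; apply: contraTneq co_pm => ->; rewrite prime_coprime ?dvdn0.
elim: (logn p k) => [|e IHe].
  rewrite expn0 muln1 (logn_coprime co_pm) addn0 subX1 mulnC logn_Gauss //.
  by rewrite -coprime_modr geometric_sum_mod // coprime_modr.
set X := x ^ (m * p ^ e) in IHe *.
have X_gt1 : 1 < X.
  by rewrite -(expn0 x) ltn_exp2l // muln_gt0 m_gt0 expn_gt0 prime_gt0.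
have X_gt0 := ltnW X_gt1.
have p_X : p %| X - 1.
  by rewrite dvdn_sub1 // /X (eqn_modX _ _ _ _ x1) exp1n.
rewrite expnSr mulnA expnM -/X subX1.
rewrite lognM ?subn_gt0 ?geometric_sum_gt0 ?prime_gt0 //.
rewrite logn_geometric_sum_prime // IHe.
rewrite [logn p (_ * _ * p)]lognM ?muln_gt0 ?m_gt0 ?expn_gt0 ?prime_gt0 //.
by rewrite (logn_prime _ p_pr) eqxx addnA.
Qed.

Lemma mersenne_gt0 (n : nat) : 0 < n -> 0 < mersenne n.
Proof. by move=> n_gt0; rewrite subn_gt0 -(expn0 2) ltn_exp2l. Qed.

Lemma dvdn_mersenne (p n : nat) : (p %| mersenne n) = (2 ^ n == 1 %[mod p]).
Proof. by rewrite dvdn_sub1 ?expn_gt0. Qed.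

Lemma mersenne_orderP (p : nat) : odd p ->
  [/\ 0 < mersenne_order p, p %| mersenne (mersenne_order p)
    & forall r, 0 < r -> p %| mersenne r -> mersenne_order p <= r].
Proof.
move=> p_odd; rewrite /mersenne_order; case: ex_minnP => v.
rewrite /is_mersenne_exponent /= p_odd /= => /andP[v_gt0 p_v] v_min.
split=> // r r_gt0 p_r.
by apply: v_min; rewrite r_gt0.
Qed.

(** Modulo [p], [2 ^ n] depends only on the remainder of [n] by the order, and
    minimality of the order excludes a nonzero remainder. *)
Lemma dvdn_mersenne_order (p n : nat) :
  odd p -> (p %| mersenne n) = (mersenne_order p %| n).
Proof.
move=> p_odd; have [v_gt0 p_v v_min] := mersenne_orderP _ p_odd.
set v := mersenne_order p in v_gt0 p_v v_min *.
have v1 : 2 ^ v = 1 %[mod p] by apply/eqP; rewrite -dvdn_mersenne.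
have n_mod : 2 ^ n = 2 ^ (n %% v) %[mod p].
  rewrite {1}(divn_eq n v) expnD mulnC [_ * v]mulnC expnM.
  by rewrite -modnMmr (eqn_modX _ _ _ _ v1) exp1n modnMmr muln1.
rewrite dvdn_mersenne n_mod -dvdn_mersenne [in RHS]/dvdn.
case: (posnP (n %% v)) => [->|r_gt0]; first exact: dvdn0.
apply/negbTE/negP => /(v_min _ r_gt0).
by rewrite leqNgt ltn_pmod.
Qed.

(** Fermat's little theorem exhibits [p - 1] as an exponent. *)
Lemma mersenne_order_lt (p : nat) : prime p -> odd p -> mersenne_order p < p.
Proof.
move=> p_pr p_odd; have [_ _ v_min] := mersenne_orderP _ p_odd.
rewrite -[X in _ < X](prednK (prime_gt0 p_pr)) ltnS v_min //.
  by rewrite -subn1 subn_gt0 prime_gt1.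
rewrite dvdn_mersenne -[p.-1]muln1 -(totient_pfactor p_pr (ltn0Sn 0)) expn1.
by apply/eqP/Euler_exp_totient; rewrite coprime2n.
Qed.

(** Lifting the exponent with base [2 ^ v], [v] the order of [p]; since
    [0 < v < p], the cofactor [n / v] has the same valuation as [n]. *)
Lemma logn_mersenne (p n : nat) :
    prime p -> odd p -> 0 < n -> mersenne_order p %| n ->
  logn p (mersenne n) = wieferich_exponent p + logn p n.
Proof.
move=> p_pr p_odd n_gt0 /dvdnP[k def_n]; move: n_gt0; rewrite def_n.
have [v_gt0 p_v _] := mersenne_orderP _ p_odd.
rewrite /wieferich_exponent; set v := mersenne_order p in v_gt0 p_v *.
rewrite muln_gt0 v_gt0 andbT => k_gt0.
have p_notin_v : logn p v = 0.
  by rewrite logn_coprime // prime_coprime // gtnNdvd ?mersenne_order_lt.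
rewrite lognM // p_notin_v addn0 /mersenne mulnC expnM logn_subX1 //.
by rewrite -(expn0 2) ltn_exp2l.
Qed.

Lemma odd_mersenne (n : nat) : 0 < n -> odd (mersenne n).
Proof.
by move=> n_gt0; rewrite /mersenne oddB ?expn_gt0 // oddX /= eqn0Ngt n_gt0.
Qed.

Theorem corollary1p4 (n : nat) (hn : 1 <= n) :
  let A := [set p : nat | [/\ prime p, odd p & mersenne_order p %| n]] in
  finite_set A /\
  mersenne n = \big[muln/1]_(p \in A) p ^ (wieferich_exponent p + logn p n).
Proof.
move=> A.
have M_gt0 := mersenne_gt0 n hn.
have A_primes : A = [set` primes (mersenne n)].
  apply/seteqP; split=> p /=; rewrite mem_primes M_gt0 /=.
    by case=> p_pr p_odd v_n; rewrite p_pr dvdn_mersenne_order.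
  case/andP=> p_pr p_M; have p_odd := dvdn_odd p_M (odd_mersenne n hn).
  by split=> //; rewrite -dvdn_mersenne_order.
split; first by rewrite A_primes; exact: finite_seq.
transitivity (\big[muln/1]_(p \in A) p ^ logn p (mersenne n)).
  rewrite A_primes -fsbig_seq ?primes_uniq //.
  by rewrite {1}(prod_prime_decomp M_gt0) prime_decompE big_map.
apply: eq_fsbigr => p; rewrite inE => -[p_pr p_odd v_n].
by rewrite logn_mersenne.
Qed.
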